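(* Let $C\in\mathcal{L}(\mathfrak{X})$ be a contraction (i.e. $\|C\|\le 1$) on a Banach space $\mathfrak{X}$. Then $\{e^{t(C-\mathbf{1})}\}_{t\ge 0}$ is a norm-continuous contractive semigroup on $\mathfrak{X}$, and for all $n\in\mathbb{N}$ and $x\in\mathfrak{X}$, $$\|(C^n-e^{n(C-\mathbf{1})})x\|\le \frac{n}{2}\left(\|(C-\mathbf{1})^2x\|+\frac{e^2}{3}\,\|(C-\mathbf{1})^3x\|\right).$$
   Context: $\mathcal{L}(\mathfrak{X})$ denotes the bounded linear operators on $\mathfrak{X}$, $\mathbf{1}$ is the identity operator, and $\mathbb{N}=\{1,2,\dots\}$. *)

(* Defs.v *)
From Stdlib Require Import Reals Factorial Lra ClassicalEpsilon.
From Stdlib Require Import FunctionalExtensionality PropExtensionality.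
From Stdlib Require Import ProofIrrelevance.
From Coquelicot Require Import Coquelicot.

Open Scope R_scope.

(* The scalar field of a Banach space is the field of real or of complex
   numbers.  Coquelicot's [norm] is real-valued in both cases. *)
Variant scalar_field : Set := real_field | complex_field.

Definition scalars (F : scalar_field) : AbsRing :=
  match F with
  | real_field => R_AbsRing
  | complex_field => C_AbsRing
  end.

Definition of_real (F : scalar_field) : R -> scalars F :=
  match F with
  | real_field => fun t => t
  | complex_field => RtoC
  end.

Lemma scalars_mult_comm (F : scalar_field) (a b : scalars F) :
  mult a b = mult b a.
Proof. destruct F; [exact (Rmult_comm a b) | exact (Cmult_comm a b)]. Qed.

Lemma abs_of_real (F : scalar_field) (t : R) : abs (of_real F t) = Rabs t.
Proof. destruct F; [reflexivity | exact (Cmod_R t)]. Qed.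

Lemma of_real_1 (F : scalar_field) : of_real F 1 = one.
Proof. destruct F; reflexivity. Qed.

Lemma of_real_mult (F : scalar_field) (s t : R) :
  of_real F (s * t) = mult (of_real F s) (of_real F t).
Proof. destruct F; [reflexivity | exact (RtoC_mult s t)]. Qed.

Lemma of_real_plus (F : scalar_field) (s t : R) :
  of_real F (s + t) = plus (of_real F s) (of_real F t).
Proof. destruct F; [reflexivity | exact (RtoC_plus s t)]. Qed.

Lemma filterlim_norm_minus_le {K : AbsRing} {V : NormedModule K} {T : Type}
    {G : (T -> Prop) -> Prop} {PG : ProperFilter G}
    (f : T -> V) (y c : V) (M : R) :
  filterlim f G (locally y) -> G (fun a => norm (minus (f a) c) <= M) ->
  norm (minus y c) <= M.
Proof.
intros Hf HM.
assert (H : filterlim (fun a => norm (minus (f a) c)) G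
              (locally (norm (minus y c)))).
{ apply filterlim_comp with (G := locally (minus y c)).
  - unfold minus.
    apply (filterlim_comp_2 (F := G) (G := locally y)
             (H := locally (opp c)) f (fun _ => opp c) plus).
    + exact Hf.
    + apply filterlim_const.
    + apply filterlim_plus.
  - apply filterlim_norm. }
apply (filterlim_le (F := G) (fun a => norm (minus (f a) c)) (fun _ => M)
         (Finite (norm (minus y c))) (Finite M) HM H).
apply filterlim_const.
Qed.

Section BoundedOperators.

Context {F : scalar_field} {X : NormedModule (scalars F)}.

(* [is_linear] contains the existence of a bound [norm (A x) <= M * norm x]. *)
Record bounded_op : Type := BoundedOp {
  bounded_op_fun :> X -> X;
  bounded_op_linear : is_linear bounded_op_fun }.

Implicit Types A B : bounded_op.

Lemma bounded_op_eq A B : (forall x, A x = B x) -> A = B.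
Proof.
destruct A as [f hf], B as [g hg]; simpl; intros H.
apply functional_extensionality in H; subst g.
now rewrite (proof_irrelevance _ hf hg).
Qed.

Lemma plus_is_linear A B : is_linear (fun x => plus (A x) (B x)).
Proof.
apply (is_linear_comp (fun x => (A x, B x)) (fun p => plus (fst p) (snd p))).
- apply is_linear_prod; apply bounded_op_linear.
- apply is_linear_plus.
Qed.

Lemma scal_is_linear (k : scalars F) A : is_linear (fun x => scal k (A x)).
Proof.
apply (is_linear_comp A (fun x => scal k x)).
- apply bounded_op_linear.
- apply is_linear_scal_r; intros n m; apply scalars_mult_comm.
Qed.

Definition op_zero : bounded_op := BoundedOp (fun _ => zero) is_linear_zero.

Definition op_plus A B : bounded_op :=
  BoundedOp (fun x => plus (A x) (B x)) (plus_is_linear A B).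

Definition op_opp A : bounded_op :=
  BoundedOp (fun x => opp (A x))
    (is_linear_comp A opp (bounded_op_linear A) is_linear_opp).

Definition op_scal (k : scalars F) A : bounded_op :=
  BoundedOp (fun x => scal k (A x)) (scal_is_linear k A).

Definition op_one : bounded_op := BoundedOp (fun x => x) is_linear_id.

Definition op_comp A B : bounded_op :=
  BoundedOp (fun x => A (B x))
    (is_linear_comp B A (bounded_op_linear B) (bounded_op_linear A)).

Definition op_norm A : R :=
  real (Lub_Rbar (fun r => exists x : X, norm x <= 1 /\ r = norm (A x))).

Lemma op_plus_comm A B : op_plus A B = op_plus B A.
Proof. apply bounded_op_eq; intros x; apply (plus_comm (A x) (B x)). Qed.

Lemma op_plus_assoc A B D : op_plus A (op_plus B D) = op_plus (op_plus A B) D.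
Proof. apply bounded_op_eq; intros x; apply (plus_assoc (A x) (B x) (D x)). Qed.

Lemma op_plus_zero_r A : op_plus A op_zero = A.
Proof. apply bounded_op_eq; intros x; apply (plus_zero_r (A x)). Qed.

Lemma op_plus_opp_r A : op_plus A (op_opp A) = op_zero.
Proof. apply bounded_op_eq; intros x; apply (plus_opp_r (A x)). Qed.

Definition op_AbelianMonoid_mixin :=
  AbelianMonoid.Mixin bounded_op op_plus op_zero
    op_plus_comm op_plus_assoc op_plus_zero_r.

Canonical op_AbelianMonoid :=
  AbelianMonoid.Pack bounded_op op_AbelianMonoid_mixin bounded_op.

Definition op_AbelianGroup_mixin :=
  AbelianGroup.Mixin op_AbelianMonoid op_opp op_plus_opp_r.

Canonical op_AbelianGroup :=
  AbelianGroup.Pack bounded_op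
    (AbelianGroup.Class _ op_AbelianMonoid_mixin op_AbelianGroup_mixin)
    bounded_op.

Lemma minus_opE A B (x : X) : (minus A B : bounded_op) x = minus (A x) (B x).
Proof. reflexivity. Qed.

Lemma op_comp_assoc A B D : op_comp A (op_comp B D) = op_comp (op_comp A B) D.
Proof. apply bounded_op_eq; reflexivity. Qed.

Lemma op_comp_one_r A : op_comp A op_one = A.
Proof. apply bounded_op_eq; reflexivity. Qed.

Lemma op_comp_one_l A : op_comp op_one A = A.
Proof. apply bounded_op_eq; reflexivity. Qed.

Lemma op_comp_plus_l A B D :
  op_comp (plus A B) D = plus (op_comp A D) (op_comp B D).
Proof. apply bounded_op_eq; reflexivity. Qed.

Lemma op_comp_plus_r A B D :
  op_comp A (plus B D) = plus (op_comp A B) (op_comp A D).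
Proof.
apply bounded_op_eq; intros x.
exact (linear_plus A (bounded_op_linear A) (B x) (D x)).
Qed.

Definition op_Ring_mixin :=
  Ring.Mixin op_AbelianGroup op_comp op_one op_comp_assoc
    op_comp_one_r op_comp_one_l op_comp_plus_l op_comp_plus_r.

Canonical op_Ring :=
  Ring.Pack bounded_op
    (Ring.Class _ (AbelianGroup.class op_AbelianGroup) op_Ring_mixin)
    bounded_op.

Lemma op_scal_assoc (k l : scalars F) A :
  op_scal k (op_scal l A) = op_scal (mult k l) A.
Proof. apply bounded_op_eq; intros x; apply (scal_assoc k l (A x)). Qed.

Lemma op_scal_one A : op_scal one A = A.
Proof. apply bounded_op_eq; intros x; apply (scal_one (A x)). Qed.

Lemma op_scal_plus_l (k : scalars F) A B :
  op_scal k (plus A B) = plus (op_scal k A) (op_scal k B).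
Proof. apply bounded_op_eq; intros x; apply (scal_distr_l k (A x) (B x)). Qed.

Lemma op_scal_plus_r (k l : scalars F) A :
  op_scal (plus k l) A = plus (op_scal k A) (op_scal l A).
Proof. apply bounded_op_eq; intros x; apply (scal_distr_r k l (A x)). Qed.

Definition op_ModuleSpace_mixin :=
  ModuleSpace.Mixin (scalars F) op_AbelianGroup op_scal
    op_scal_assoc op_scal_one op_scal_plus_l op_scal_plus_r.

Canonical op_ModuleSpace :=
  ModuleSpace.Pack (scalars F) bounded_op
    (ModuleSpace.Class _ _ (AbelianGroup.class op_AbelianGroup)
       op_ModuleSpace_mixin)
    bounded_op.

Lemma norm_scal_of_real (t : R) (x : X) :
  norm (scal (of_real F t) x) = Rabs t * norm x.
Proof.
apply Rle_antisym.
{ rewrite <- (abs_of_real F t); apply norm_scal. }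
destruct (Req_dec t 0) as [-> | Ht].
{ rewrite Rabs_R0, Rmult_0_l; apply norm_ge_0. }
assert (Ha : 0 < Rabs t) by now apply Rabs_pos_lt.
assert (H : norm x <= / Rabs t * norm (scal (of_real F t) x)).
{ rewrite <- (scal_one x) at 1.
  rewrite <- (of_real_1 F).
  replace 1 with (/ t * t) by now field.
  rewrite of_real_mult, <- scal_assoc.
  rewrite <- Rabs_inv, <- (abs_of_real F (/ t)); apply norm_scal. }
apply Rmult_le_reg_l with (/ Rabs t); [now apply Rinv_0_lt_compat |].
rewrite <- Rmult_assoc, Rinv_l, Rmult_1_l by lra; exact H.
Qed.

Lemma op_norm_is_lub A :
  is_lub_Rbar (fun r => exists x : X, norm x <= 1 /\ r = norm (A x))
    (op_norm A).
Proof.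
unfold op_norm.
set (E := fun r => exists x : X, norm x <= 1 /\ r = norm (A x)).
destruct (linear_norm A (bounded_op_linear A)) as [M [HM0 HM]].
destruct (Lub_Rbar_correct E) as [H1 H2].
assert (H0 : E 0).
{ exists zero; split; [rewrite norm_zero; lra |].
  now rewrite (linear_zero A (bounded_op_linear A)), norm_zero. }
assert (Hub : is_ub_Rbar E M).
{ intros r [x [Hx ->]]; simpl.
  apply Rle_trans with (1 := HM x).
  rewrite <- (Rmult_1_r M) at 2.
  apply Rmult_le_compat_l; lra. }
generalize (H1 _ H0) (H2 _ Hub).
intros H3 H4; destruct (Lub_Rbar E) as [l | |]; simpl in *; easy.
Qed.

Lemma op_norm_le A (M : R) :
  (forall x : X, norm x <= 1 -> norm (A x) <= M) -> op_norm A <= M.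
Proof.
intros H; apply (proj2 (op_norm_is_lub A) (Finite M)).
intros r [x [Hx ->]]; now apply H.
Qed.

Lemma op_norm_unit A (x : X) : norm x <= 1 -> norm (A x) <= op_norm A.
Proof.
intros Hx; apply (proj1 (op_norm_is_lub A)); now exists x.
Qed.

Lemma op_norm_ge_0 A : 0 <= op_norm A.
Proof.
apply Rle_trans with (norm (A zero)); [apply norm_ge_0 |].
apply op_norm_unit; rewrite norm_zero; lra.
Qed.

Lemma op_norm_apply A (x : X) : norm (A x) <= op_norm A * norm x.
Proof.
destruct (Req_dec (norm x) 0) as [H0 | H0].
{ rewrite (norm_eq_zero x H0), (linear_zero A (bounded_op_linear A)).
  rewrite norm_zero; lra. }
assert (Hx : 0 < norm x) by (generalize (norm_ge_0 x); lra).
assert (Hi : 0 < / norm x) by now apply Rinv_0_lt_compat.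
assert (H : norm (A (scal (of_real F (/ norm x)) x)) <= op_norm A).
{ apply op_norm_unit; rewrite norm_scal_of_real, Rabs_pos_eq by lra.
  rewrite Rinv_l; lra. }
rewrite (linear_scal A (bounded_op_linear A)), norm_scal_of_real in H.
rewrite Rabs_pos_eq in H by lra.
apply Rmult_le_reg_l with (/ norm x); [exact Hi |].
replace (/ norm x * (op_norm A * norm x)) with (op_norm A) by (field; lra).
exact H.
Qed.

Lemma op_norm_le_apply A (M : R) :
  0 <= M -> (forall x : X, norm (A x) <= M * norm x) -> op_norm A <= M.
Proof.
intros HM H; apply op_norm_le; intros x Hx.
apply Rle_trans with (1 := H x).
rewrite <- (Rmult_1_r M) at 2; now apply Rmult_le_compat_l.
Qed.

Lemma op_norm_plus A B : op_norm (plus A B) <= op_norm A + op_norm B.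
Proof.
apply op_norm_le; intros x Hx.
apply Rle_trans with (1 := norm_triangle (A x) (B x)).
now apply Rplus_le_compat; apply op_norm_unit.
Qed.

Lemma op_norm_scal (k : scalars F) A :
  op_norm (scal k A) <= abs k * op_norm A.
Proof.
apply op_norm_le; intros x Hx.
apply Rle_trans with (1 := norm_scal k (A x)).
apply Rmult_le_compat_l; [apply abs_ge_0 | now apply op_norm_unit].
Qed.

Lemma op_norm_opp A : op_norm (opp A) = op_norm A.
Proof.
assert (H : forall B, op_norm (opp B) <= op_norm B).
{ intros B; apply op_norm_le; intros x Hx.
  apply Rle_trans with (norm (B x)); [| now apply op_norm_unit].
  apply Req_le, (norm_opp (B x)). }
apply Rle_antisym; [apply H |].
rewrite <- (opp_opp A) at 1; apply H.
Qed.

Lemma op_norm_minus_sym A B : op_norm (minus A B) = op_norm (minus B A).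
Proof. now rewrite <- op_norm_opp, opp_minus. Qed.

Lemma op_norm_zero : op_norm zero = 0.
Proof.
apply Rle_antisym; [| apply op_norm_ge_0].
apply op_norm_le; intros x _; apply Req_le, norm_zero.
Qed.

Lemma op_norm_eq_zero A : op_norm A = 0 -> A = zero.
Proof.
intros H; apply bounded_op_eq; intros x.
apply norm_eq_zero, Rle_antisym; [| apply norm_ge_0].
apply Rle_trans with (1 := op_norm_apply A x).
rewrite H, Rmult_0_l; apply Rle_refl.
Qed.

Lemma op_norm_comp A B : op_norm (mult A B) <= op_norm A * op_norm B.
Proof.
apply op_norm_le; intros x Hx.
apply Rle_trans with (1 := op_norm_apply A (B x)).
apply Rmult_le_compat_l; [apply op_norm_ge_0 | now apply op_norm_unit].
Qed.

Lemma op_norm_one : op_norm one <= 1.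
Proof. now apply op_norm_le. Qed.

Definition op_ball A (e : R) B : Prop := op_norm (minus B A) < e.

Lemma op_ball_center A (e : posreal) : op_ball A e A.
Proof.
unfold op_ball; rewrite minus_eq_zero.
apply Rle_lt_trans with (2 := cond_pos e); apply Req_le, op_norm_zero.
Qed.

Lemma op_ball_sym A B (e : R) : op_ball A e B -> op_ball B e A.
Proof. unfold op_ball; now rewrite op_norm_minus_sym. Qed.

Lemma op_ball_triangle A B D (e1 e2 : R) :
  op_ball A e1 B -> op_ball B e2 D -> op_ball A (e1 + e2) D.
Proof.
unfold op_ball; intros H1 H2.
rewrite (minus_trans B D A).
apply Rle_lt_trans with (1 := op_norm_plus _ _); lra.
Qed.

Definition op_UniformSpace_mixin :=
  UniformSpace.Mixin bounded_op op_zero op_ball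
    op_ball_center op_ball_sym op_ball_triangle.

Canonical op_UniformSpace :=
  UniformSpace.Pack bounded_op op_UniformSpace_mixin bounded_op.

Canonical op_NormedModuleAux :=
  NormedModuleAux.Pack (scalars F) bounded_op
    (NormedModuleAux.Class (scalars F) bounded_op
       (ModuleSpace.class (scalars F) op_ModuleSpace) op_UniformSpace_mixin)
    bounded_op.

Lemma op_norm_ball A B (e : R) : op_norm (minus B A) < e -> ball A e B.
Proof. easy. Qed.

Lemma op_ball_norm A B (e : posreal) :
  ball A e B -> op_norm (minus B A) < 1 * e.
Proof. now rewrite Rmult_1_l. Qed.

Definition op_NormedModule_mixin :=
  NormedModule.Mixin (scalars F) op_NormedModuleAux op_norm 1
    op_norm_plus op_norm_scal op_norm_ball op_ball_norm op_norm_eq_zero.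

Canonical op_NormedModule :=
  NormedModule.Pack (scalars F) bounded_op
    (NormedModule.Class (scalars F) bounded_op
       (NormedModuleAux.class (scalars F) op_NormedModuleAux)
       op_NormedModule_mixin)
    bounded_op.

Lemma op_complete_of_pointwise (G : (bounded_op -> Prop) -> Prop) :
  ProperFilter G -> cauchy G ->
  (forall x : X, exists y : X, filterlim (fun A => A x) G (locally y)) ->
  exists A, forall eps : posreal, G (ball A eps).
Proof.
intros PG HG Hpt.
pose (L := fun x => proj1_sig (constructive_indefinite_description _
                                 (Hpt x))).
assert (HL : forall x, filterlim (fun A => A x) G (locally (L x))).
{ intros x; unfold L; now destruct constructive_indefinite_description. }
clearbody L.
assert (Hlim : forall A0 e, 0 <= e -> G (ball A0 e) ->
          forall x, norm (minus (L x) (A0 x)) <= e * norm x).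
{ intros A0 e He HA0 x.
  apply (filterlim_norm_minus_le _ _ _ _ (HL x)).
  revert HA0; apply filter_imp; intros A HA.
  rewrite <- minus_opE.
  apply Rle_trans with (1 := op_norm_apply _ x).
  apply Rmult_le_compat_r; [apply norm_ge_0 | now apply Rlt_le]. }
assert (linL : is_linear L).
{ split.
  - intros x y.
    apply (filterlim_locally_unique (F := G) (fun A : bounded_op => A (plus x y)));
      [apply HL |].
    apply filterlim_ext with (fun A : bounded_op => plus (A x) (A y)).
    { intros A; symmetry; apply linear_plus, bounded_op_linear. }
    apply (filterlim_comp_2 (F := G) (G := locally (L x)) (H := locally (L y))
             (fun A : bounded_op => A x) (fun A : bounded_op => A y) plus).
    + apply HL.
    + apply HL.
    + apply filterlim_plus.
  - intros k x.
    apply (filterlim_locally_unique (F := G) (fun A : bounded_op => A (scal k x)));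
      [apply HL |].
    apply filterlim_ext with (fun A : bounded_op => scal k (A x)).
    { intros A; symmetry; apply linear_scal, bounded_op_linear. }
    apply (filterlim_comp _ _ _ (fun A : bounded_op => A x) (fun y => scal k y)
             G (locally (L x))); [apply HL | apply filterlim_scal_r].
  - destruct (HG (mkposreal 1 Rlt_0_1)) as [A0 HA0]; simpl in HA0.
    exists (op_norm A0 + 1); split.
    { generalize (op_norm_ge_0 A0); lra. }
    intros x.
    replace (L x) with (plus (minus (L x) (A0 x)) (A0 x)).
    2: { unfold minus; now rewrite <- plus_assoc, plus_opp_l, plus_zero_r. }
    apply Rle_trans with (1 := norm_triangle _ _).
    generalize (Hlim A0 1 Rle_0_1 HA0 x) (op_norm_apply A0 x); lra. }
exists (BoundedOp L linL); intros eps.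
assert (He : 0 < eps / 4) by (generalize (cond_pos eps); lra).
destruct (HG (mkposreal _ He)) as [A0 HA0]; simpl in HA0.
assert (H0 : op_norm (minus A0 (BoundedOp L linL)) <= eps / 4).
{ rewrite op_norm_minus_sym; apply op_norm_le_apply; [lra |].
  intros x; rewrite minus_opE; simpl; apply Hlim; [lra | exact HA0]. }
assert (H1 : ball (BoundedOp L linL) (eps / 2) A0).
{ apply Rle_lt_trans with (1 := H0); lra. }
revert HA0; apply filter_imp; intros A HA.
replace (pos eps) with (eps / 2 + eps / 2) by field.
apply ball_triangle with A0; [exact H1 |].
apply Rlt_trans with (1 := HA); lra.
Qed.

Lemma op_norm_pow A (k : nat) : op_norm (pow_n A k) <= op_norm A ^ k.
Proof.
induction k as [| k IH]; [apply op_norm_one |].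
apply Rle_trans with (1 := op_norm_comp A (pow_n A k)).
apply Rmult_le_compat_l; [apply op_norm_ge_0 | exact IH].
Qed.

(* [locally] on [bounded_op] is the operator-norm topology. *)
Record norm_continuous_contraction_semigroup (T : R -> bounded_op) : Prop := {
  semigroup_0 : T 0 = one;
  semigroup_plus : forall s t : R,
    0 <= s -> 0 <= t -> T (s + t) = mult (T s) (T t);
  semigroup_continuous : forall t : R,
    0 <= t ->
    filterlim T (within (fun s => 0 <= s) (locally t)) (locally (T t));
  semigroup_contractive : forall t : R, 0 <= t -> norm (T t) <= 1 }.

End BoundedOperators.

Arguments bounded_op {F} X.

Section Completeness.

Context {F : scalar_field} {X : CompleteNormedModule (scalars F)}.

Notation bounded_op := (bounded_op X).

Implicit Types A B : bounded_op.

Lemma op_cauchy_apply (G : (bounded_op -> Prop) -> Prop) :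
  ProperFilter G -> cauchy G ->
  forall x : X, exists y : X, filterlim (fun A => A x) G (locally y).
Proof.
intros PG HG x.
apply (filterlim_locally_cauchy (F := G) (fun A : bounded_op => A x)).
intros eps.
assert (Hx : 0 < norm x + 1) by (generalize (norm_ge_0 x); lra).
assert (He : 0 < eps / 2 / (norm x + 1)).
{ apply Rdiv_lt_0_compat; [apply is_pos_div_2 | exact Hx]. }
destruct (HG (mkposreal _ He)) as [A0 HA0].
exists (ball A0 (mkposreal _ He)); split; [exact HA0 |].
intros A B HA HB; apply (norm_compat1 (V := X)).
assert (HD : op_norm (minus B A) < eps / (norm x + 1)).
{ replace (eps / (norm x + 1))
    with (eps / 2 / (norm x + 1) + eps / 2 / (norm x + 1)) by (field; lra).
  apply op_ball_triangle with A0; [now apply op_ball_sym | exact HB]. }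
rewrite <- minus_opE.
apply Rle_lt_trans with (1 := op_norm_apply _ x).
apply Rle_lt_trans with (op_norm (minus B A) * (norm x + 1)).
{ apply Rmult_le_compat_l; [apply op_norm_ge_0 | lra]. }
replace (pos eps) with (eps / (norm x + 1) * (norm x + 1)) by (field; lra).
now apply Rmult_lt_compat_r.
Qed.

Lemma op_complete (G : (bounded_op -> Prop) -> Prop) :
  ProperFilter G -> cauchy G ->
  exists A, forall eps : posreal, G (ball A eps).
Proof.
intros PG HG; apply op_complete_of_pointwise; [assumption .. |].
now apply op_cauchy_apply.
Qed.

Definition op_lim (G : (bounded_op -> Prop) -> Prop) : bounded_op :=
  epsilon (inhabits op_zero) (fun A => forall eps : posreal, G (ball A eps)).

Lemma op_lim_correct (G : (bounded_op -> Prop) -> Prop) :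
  ProperFilter G -> cauchy G ->
  forall eps : posreal, G (ball (op_lim G) eps).
Proof.
intros PG HG; unfold op_lim; apply epsilon_spec, op_complete; assumption.
Qed.

Lemma op_lim_close (G1 G2 : (bounded_op -> Prop) -> Prop) :
  filter_le G1 G2 -> filter_le G2 G1 -> close (op_lim G1) (op_lim G2).
Proof.
intros H12 H21; replace G2 with G1; [apply close_refl |].
apply functional_extensionality; intros P.
apply propositional_extensionality; split; [apply H21 | apply H12].
Qed.

Definition op_CompleteSpace_mixin :=
  CompleteSpace.Mixin op_UniformSpace op_lim op_lim_correct op_lim_close.

Canonical op_CompleteSpace :=
  CompleteSpace.Pack bounded_op
    (CompleteSpace.Class _ op_UniformSpace_mixin op_CompleteSpace_mixin)
    bounded_op.

Canonical op_CompleteNormedModule :=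
  CompleteNormedModule.Pack (scalars F) bounded_op
    (CompleteNormedModule.Class (scalars F) bounded_op
       (NormedModule.class (scalars F) op_NormedModule)
       op_CompleteSpace_mixin)
    bounded_op.

(* [is_series] on [bounded_op] is convergence in the operator norm. *)

Definition exp_term A (k : nat) : bounded_op :=
  scal (of_real F (/ INR (fact k))) (pow_n A k).

Definition op_exp A : bounded_op :=
  iota (fun E : bounded_op => is_series (exp_term A) E).

Lemma op_exp_correct A : is_series (exp_term A) (op_exp A).
Proof.
assert (H : ex_series (exp_term A)).
{ apply (ex_series_le (V := op_CompleteNormedModule) _
    (fun k => / INR (fact k) * op_norm A ^ k)).
  - intros k.
    apply Rle_trans with (1 := op_norm_scal _ _).
    rewrite abs_of_real, Rabs_pos_eq.
    2: apply Rlt_le, Rinv_0_lt_compat, INR_fact_lt_0.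
    apply Rmult_le_compat_l; [| apply op_norm_pow].
    apply Rlt_le, Rinv_0_lt_compat, INR_fact_lt_0.
  - exists (exp (op_norm A)); apply is_pseries_R, is_exp_Reals. }
destruct H as [E HE].
replace (op_exp A) with E; [exact HE |].
symmetry; exact (iota_filterlim_locally (V := op_CompleteNormedModule)
                   (F := eventually) _ _ HE).
Qed.

End Completeness.

(* Main.v *)
Require Import Defs.
From Stdlib Require Import Reals Lra Lia Factorial.
From Coquelicot Require Import Coquelicot.

Open Scope R_scope.

(** Write A = C - 1.

    Since A and 1 commute with C, the exponential law gives
    e^(tA) = e^(tC) e^(-t), hence ||e^(tA)|| <= e^(t ||C||) e^(-t) <= 1 for
    t >= 0: this is [op_exp_contraction].  The semigroup law is again the
    exponential law, and norm continuity follows from it together with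
    ||e^B - 1|| <= e^||B|| ||B||, applied to B = (s - t) A.  The exponential law
    [op_exp_plus] rests on the Cauchy product of absolutely convergent series
    of operators, [is_series_convolution].

    For the estimate, put E = e^A, so that e^(nA) = E^n.  Both C and E are
    contractions and they commute, so the telescoping sum
    C^n - E^n = sum_(j < n) C^(n-1-j) E^j (C - E) yields
    ||(C^n - E^n) x|| <= n ||(C - E) x|| ([norm_pow_minus_pow]).  Finally
    C - E = (1 + A) - e^A is minus A^2/2 minus the Taylor remainder of order
    three, which at x has norm at most e^||A|| / 3! ||A^3 x||
    ([op_exp_taylor_remainder]), and ||A|| <= 2 ([norm_minus_op_exp]). *)

(** * Limits and series in normed modules *)

Lemma filterlim_of_norm_le {K : AbsRing} {V : NormedModule K} {T : Type}
    {G : (T -> Prop) -> Prop} {FG : Filter G} (f : T -> V) (l : V) (e : T -> R) :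
  (forall t, norm (minus (f t) l) <= e t) -> filterlim e G (locally 0) ->
  filterlim f G (locally l).
Proof.
intros H He; apply filterlim_locally; intros eps.
generalize (proj1 (filterlim_locally e 0) He eps); apply filter_imp.
intros t Ht; apply norm_compat1.
apply Rle_lt_trans with (1 := H t).
apply Rle_lt_trans with (1 := Rle_abs _).
change (Rabs (e t - 0) < eps) in Ht; now rewrite Rminus_0_r in Ht.
Qed.

Lemma is_series_linear {K : AbsRing} {U V : NormedModule K} (f : U -> V)
    (u : nat -> U) (l : U) :
  is_linear f -> is_series u l -> is_series (fun k => f (u k)) (f l).
Proof.
intros Hf Hu.
apply filterlim_ext with (fun n => f (sum_n u n)).
{ induction x as [| n IH]; [now rewrite !sum_O |].
  now rewrite !sum_Sn, (linear_plus f Hf), IH. }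
apply filterlim_comp with (1 := Hu); now apply linear_cont.
Qed.

Lemma is_series_norm_le {K : AbsRing} {V : NormedModule K}
    (u : nat -> V) (l : V) (a : nat -> R) (s : R) :
  is_series u l -> is_series a s -> (forall k, norm (u k) <= a k) ->
  norm l <= s.
Proof.
intros Hu Ha H.
apply (filterlim_le (F := eventually) (fun n => norm (sum_n u n)) (sum_n a)
         (norm l) s).
- apply filter_forall; intros n.
  apply Rle_trans with (1 := norm_sum_n_m u 0 n); now apply sum_n_m_le.
- apply filterlim_comp with (1 := Hu); apply filterlim_norm.
- exact Ha.
Qed.

Lemma plus_minus_cancel {G : AbelianGroup} (x y : G) : plus (minus x y) y = x.
Proof. unfold minus; now rewrite <- plus_assoc, plus_opp_l, plus_zero_r. Qed.

Lemma minus_plus_l {G : AbelianGroup} (x y : G) : minus x (plus x y) = opp y.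
Proof.
unfold minus; rewrite opp_plus, plus_assoc.
eapply eq_trans; [apply f_equal2; [apply plus_opp_r | reflexivity] |].
apply plus_zero_l.
Qed.

(** * Cauchy products *)

Definition convolution {K : Ring} (u v : nat -> K) (n : nat) : K :=
  sum_n (fun i => mult (u i) (v (n - i)%nat)) n.

Lemma sum_convolution {K : Ring} (u v : nat -> K) (n : nat) :
  sum_n (convolution u v) n
  = sum_n (fun i => mult (u i) (sum_n v (n - i))) n.
Proof.
induction n as [| n IH].
{ rewrite !sum_O; unfold convolution; now rewrite sum_O. }
rewrite sum_Sn, IH; unfold convolution.
rewrite !(sum_Sn _ n), plus_assoc, <- sum_n_plus, Nat.sub_diag, sum_O.
f_equal; apply sum_n_ext_loc; intros i Hi.
now rewrite Nat.sub_succ_l, sum_Sn, mult_distr_l by assumption.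
Qed.

(** The product of two partial sums ranges over a square of index pairs and the
    sum of the convolutions over a triangle inside it.  Grouping the
    missing pairs by their first index leaves products of terms of [u] with
    tails of partial sums of [v], an expression whose norm can be estimated
    term by term. *)
Lemma convolution_remainder {K : Ring} (u v : nat -> K) (n : nat) :
  minus (mult (sum_n u n) (sum_n v n)) (sum_n (convolution u v) n)
  = sum_n (fun i => mult (u i) (minus (sum_n v n) (sum_n v (n - i)))) n.
Proof.
rewrite sum_convolution, <- sum_n_mult_r.
rewrite (sum_n_ext (fun i => mult (u i) (sum_n v n)) (fun i =>
  plus (mult (u i) (minus (sum_n v n) (sum_n v (n - i))))
       (mult (u i) (sum_n v (n - i))))).
2: { intros i; rewrite <- mult_distr_l.
  now rewrite (plus_minus_cancel (G := Ring.AbelianGroup K)). }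
rewrite sum_n_plus; unfold minus at 1.
now rewrite <- plus_assoc, (plus_opp_r (G := Ring.AbelianGroup K)), plus_zero_r.
Qed.

(** * Differences and powers in a ring *)

Lemma mult_minus_r {K : Ring} (x y z : K) :
  mult x (minus y z) = minus (mult x y) (mult x z).
Proof.
unfold minus; rewrite (opp_mult_r x z); exact (mult_distr_l x y (opp z)).
Qed.

Lemma mult_minus_l {K : Ring} (x y z : K) :
  mult (minus x y) z = minus (mult x z) (mult y z).
Proof.
unfold minus; rewrite (opp_mult_l y z); exact (mult_distr_r x (opp y) z).
Qed.

Lemma minus_one_comm {K : Ring} (x : K) :
  mult (minus x one) x = mult x (minus x one).
Proof. now rewrite mult_minus_l, mult_minus_r, mult_one_l, mult_one_r. Qed.

Lemma pow_n_comm_r {K : Ring} (x y : K) (n : nat) :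
  mult x y = mult y x -> mult x (pow_n y n) = mult (pow_n y n) x.
Proof.
intros H; induction n as [| n IH]; simpl.
{ now rewrite mult_one_l, mult_one_r. }
now rewrite mult_assoc, H, <- mult_assoc, IH, mult_assoc.
Qed.

(** One step of the telescoping sum for x^n - y^n; the factor [minus x y] is
    moved to the right so that, for operators, it is the first to act. *)
Lemma minus_pow_n_S {K : Ring} (x y : K) (n : nat) :
  mult x y = mult y x ->
  minus (pow_n x (S n)) (pow_n y (S n))
  = plus (mult x (minus (pow_n x n) (pow_n y n)))
         (mult (pow_n y n) (minus x y)).
Proof.
intros H; rewrite !mult_minus_r, <- (pow_n_comm_r x y n H), pow_n_comm_1.
apply (minus_trans (mult x (pow_n y n))).
Qed.

(** * Series of operators *)

Section Operators.

Context {F : scalar_field} {X : NormedModule (scalars F)}.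

Implicit Types A B : bounded_op X.

(** Dominating the operator series by the series of norms reduces the
    convergence of their Cauchy product to that of nonnegative real series:
    the bound on the right is the remainder for the norms. *)
Lemma norm_convolution_remainder (u v : nat -> bounded_op X) (n : nat) :
  let a k := norm (u k) in
  let b k := norm (v k) in
  norm (minus (mult (sum_n u n) (sum_n v n)) (sum_n (convolution u v) n))
  <= minus (mult (sum_n a n) (sum_n b n)) (sum_n (convolution a b) n).
Proof.
intros a b.
apply Rle_trans with (norm (sum_n (fun i =>
  mult (u i) (minus (sum_n v n) (sum_n v (n - i)))) n)).
{ apply Req_le, f_equal, (convolution_remainder (K := op_Ring (X := X))). }
apply Rle_trans with (sum_n (fun i =>
  mult (a i) (minus (sum_n b n) (sum_n b (n - i)))) n).
2: { apply Req_le, eq_sym, (convolution_remainder (K := R_Ring)). }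
apply Rle_trans with
  (1 := norm_sum_n_m (V := op_NormedModule (X := X)) (fun i =>
          mult (u i) (minus (sum_n v n) (sum_n v (n - i)))) 0 n).
apply sum_n_m_le; intros i.
apply Rle_trans with (1 := op_norm_comp _ _).
apply Rmult_le_compat_l; [apply op_norm_ge_0 |].
destruct (Nat.eq_dec i 0) as [-> | Hi].
{ rewrite Nat.sub_0_r, !minus_eq_zero.
  apply Req_le, op_norm_zero. }
apply Rle_trans with (norm (sum_n_m v (S (n - i)) n)).
{ apply Req_le, f_equal, eq_sym, (sum_n_m_sum_n (G := op_AbelianGroup)); lia. }
apply Rle_trans with (sum_n_m b (S (n - i)) n).
2: { apply Req_le, (sum_n_m_sum_n (G := R_AbelianGroup)); lia. }
apply (norm_sum_n_m v).
Qed.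

(** The sum of the convolutions differs from the product of the partial sums by
    a remainder bounded by the one of the series of norms, which tends to zero
    by the real Cauchy product theorem. *)
Lemma is_series_convolution (u v : nat -> bounded_op X) (U V : bounded_op X) :
  is_series u U -> is_series v V ->
  ex_series (fun k => norm (u k)) -> ex_series (fun k => norm (v k)) ->
  is_series (convolution u v) (mult U V).
Proof.
intros Hu Hv [la Ha] [lb Hb].
set (a := fun k => norm (u k)) in *; set (b := fun k => norm (v k)) in *.
destruct (filterlim_bounded (sum_n u) (ex_intro _ U Hu)) as [M HM].
assert (Hd : forall (w : nat -> bounded_op X) W, is_series w W ->
          is_lim_seq (fun n => norm (minus (sum_n w n) W)) 0).
{ intros w W Hw; replace 0 with (norm (minus W W)).
  2: { rewrite minus_eq_zero; apply op_norm_zero. }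
  apply (filterlim_comp _ _ _ (fun n => minus (sum_n w n) W) norm
           eventually (locally (minus W W))); [| apply filterlim_norm].
  apply (filterlim_comp_2 (G := locally W) (H := locally (opp W))
           (sum_n w) (fun _ => opp W) plus).
  - exact Hw.
  - apply filterlim_const.
  - apply filterlim_plus. }
assert (HR : is_series (convolution a b) (la * lb)).
{ apply is_series_ext with
    (fun n : nat => sum_f_R0 (fun k : nat => a k * b (n - k)%nat) n).
  { intros n; symmetry; apply sum_n_Reals. }
  apply is_series_mult; [exact Ha | exact Hb | |].
  - exists la; apply is_series_ext with (2 := Ha); intros k.
    symmetry; apply Rabs_pos_eq, op_norm_ge_0.
  - exists lb; apply is_series_ext with (2 := Hb); intros k.
    symmetry; apply Rabs_pos_eq, op_norm_ge_0. }
apply (filterlim_of_norm_le _ _ (fun n =>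
  (sum_n a n * sum_n b n - sum_n (convolution a b) n)
  + (M * norm (minus (sum_n v n) V) + norm (minus (sum_n u n) U) * norm V))).
- intros n.
  rewrite (minus_trans (mult (sum_n u n) (sum_n v n))).
  rewrite (minus_trans (mult (sum_n u n) V) _ (mult U V)).
  apply Rle_trans with (1 := op_norm_plus _ _), Rplus_le_compat.
  { apply Rle_trans with (2 := norm_convolution_remainder u v n).
    apply Req_le, op_norm_minus_sym. }
  apply Rle_trans with (1 := op_norm_plus _ _), Rplus_le_compat.
  + replace (minus (mult (sum_n u n) (sum_n v n)) (mult (sum_n u n) V))
      with (mult (sum_n u n) (minus (sum_n v n) V)).
    2: { apply (mult_minus_r (K := op_Ring (X := X))). }
    apply Rle_trans with (1 := op_norm_comp _ _).
    apply Rmult_le_compat_r; [apply op_norm_ge_0 | apply HM].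
  + replace (minus (mult (sum_n u n) V) (mult U V))
      with (mult (minus (sum_n u n) U) V).
    2: { apply (mult_minus_l (K := op_Ring (X := X))). }
    apply op_norm_comp.
- change (is_lim_seq (fun n =>
    (sum_n a n * sum_n b n - sum_n (convolution a b) n)
    + (M * norm (minus (sum_n v n) V) + norm (minus (sum_n u n) U) * norm V)) 0).
  replace 0 with ((la * lb - la * lb) + (M * 0 + 0 * norm V)) by ring.
  apply is_lim_seq_plus'; [apply is_lim_seq_minus' |].
  + apply is_lim_seq_mult'; assumption.
  + exact HR.
  + apply is_lim_seq_plus'; apply is_lim_seq_mult';
      first [apply is_lim_seq_const | apply Hd; assumption].
Qed.

Lemma scal_mult_r (k : scalars F) A B : mult A (scal k B) = scal k (mult A B).
Proof.
apply bounded_op_eq; intros x; apply (linear_scal A), bounded_op_linear.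
Qed.

Lemma scal_mult_l (k : scalars F) A B : mult (scal k A) B = scal k (mult A B).
Proof. now apply bounded_op_eq. Qed.

Lemma scal_of_real_inj (t : R) A B :
  t <> 0 -> scal (of_real F t) A = scal (of_real F t) B -> A = B.
Proof.
intros Ht H; apply bounded_op_eq; intros x.
rewrite <- (scal_one (A x)), <- (scal_one (B x)), <- of_real_1.
rewrite <- (Rinv_l t Ht), of_real_mult, <- !scal_assoc; f_equal.
exact (f_equal (fun D : bounded_op X => D x) H).
Qed.

Lemma scal_of_real_opp (t : R) A :
  scal (of_real F (- t)) A = opp (scal (of_real F t) A).
Proof.
replace (of_real F (- t)) with (opp (of_real F t)).
{ apply (scal_opp_l (V := op_ModuleSpace (X := X))). }
destruct F; [reflexivity | symmetry; exact (RtoC_opp t)].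
Qed.

Lemma pow_n_scal (t : R) A (k : nat) :
  pow_n (scal (of_real F t) A) k = scal (of_real F (t ^ k)) (pow_n A k).
Proof.
induction k as [| k IH]; simpl.
{ now rewrite of_real_1, scal_one. }
now rewrite IH, scal_mult_l, scal_mult_r, scal_assoc, of_real_mult.
Qed.

End Operators.

(** * The exponential of a bounded operator *)

Section Exponential.

Context {F : scalar_field} {X : CompleteNormedModule (scalars F)}.

Implicit Types A B : bounded_op X.

Lemma exp_term_0 A : exp_term A 0 = one.
Proof.
unfold exp_term; simpl; now rewrite Rinv_1, of_real_1, scal_one.
Qed.

Lemma exp_term_S A (k : nat) :
  scal (of_real F (INR (S k))) (exp_term A (S k)) = mult A (exp_term A k).
Proof.
unfold exp_term; rewrite scal_assoc, <- of_real_mult, scal_mult_r.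
do 2 f_equal.
rewrite fact_simpl, mult_INR; field; split.
- apply INR_fact_neq_0.
- now apply not_0_INR.
Qed.

Lemma norm_exp_term A (k : nat) :
  norm (exp_term A k) <= / INR (fact k) * norm A ^ k.
Proof.
apply Rle_trans with (1 := op_norm_scal _ _).
assert (H : 0 < / INR (fact k)) by apply Rinv_0_lt_compat, INR_fact_lt_0.
rewrite abs_of_real, Rabs_pos_eq by lra.
apply Rmult_le_compat_l; [lra | apply op_norm_pow].
Qed.

Lemma exp_monotone (s t : R) : s <= t -> exp s <= exp t.
Proof.
intros [H | ->]; [now apply Rlt_le, exp_increasing | apply Rle_refl].
Qed.

Lemma is_series_exp (a : R) :
  is_series (fun k => / INR (fact k) * a ^ k) (exp a).
Proof. apply is_pseries_R, is_exp_Reals. Qed.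

Lemma ex_series_norm_exp_term A : ex_series (fun k => norm (exp_term A k)).
Proof.
apply (ex_series_le (V := R_CompleteNormedModule) _
         (fun k => / INR (fact k) * norm A ^ k)).
- intros k; simpl.
  change (Rabs (norm (exp_term A k)) <= / INR (fact k) * norm A ^ k).
  rewrite Rabs_pos_eq by apply op_norm_ge_0; apply norm_exp_term.
- exists (exp (norm A)); apply is_series_exp.
Qed.

(** The recurrence c_(k+1) = (A + B) c_k / (k + 1) characterizes the
    exponential terms of A + B; proving that the convolution satisfies it
    stands in for the binomial theorem.  The factor k + 1 is split as
    i + (k + 1 - i) in the term of index i, and each half absorbs its part
    through [exp_term_S]. *)
Lemma convolution_exp_term_S A B (k : nat) :
  mult A B = mult B A ->
  scal (of_real F (INR (S k))) (convolution (exp_term A) (exp_term B) (S k))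
  = mult (plus A B) (convolution (exp_term A) (exp_term B) k).
Proof.
intros H; unfold convolution.
transitivity (sum_n (fun i => plus
  (mult (scal (of_real F (INR i)) (exp_term A i)) (exp_term B (S k - i)))
  (mult (exp_term A i)
     (scal (of_real F (INR (S k - i))) (exp_term B (S k - i))))) (S k)).
{ eapply eq_trans.
  { symmetry; apply (sum_n_scal_l (V := op_ModuleSpace (X := X))). }
  apply sum_n_ext_loc; intros i Hi.
  rewrite scal_mult_r, scal_mult_l.
  replace (INR (S k)) with (INR i + INR (S k - i)).
  2: { rewrite <- plus_INR; f_equal; lia. }
  rewrite of_real_plus.
  apply (scal_distr_r (V := op_ModuleSpace (X := X))). }
rewrite sum_n_plus.
eapply eq_trans; [| symmetry; apply op_comp_plus_l].
apply f_equal2.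
(* The term i = 0 vanishes, and shifting the index extracts a factor A. *)
- unfold sum_n at 1; rewrite sum_Sn_m, <- sum_n_m_S by lia.
  replace (of_real F (INR 0)) with (zero : scalars F) by now destruct F.
  eapply eq_trans.
  { apply f_equal2; [| reflexivity].
    eapply eq_trans; [| apply (mult_zero_l (K := op_Ring (X := X)))].
    apply f_equal2; [| reflexivity].
    apply (scal_zero_l (V := op_ModuleSpace (X := X))). }
  rewrite plus_zero_l.
  eapply eq_trans; [| apply (sum_n_mult_l (K := op_Ring (X := X)))].
  apply sum_n_ext; intros i.
  now rewrite exp_term_S, <- mult_assoc.
(* The term i = k + 1 vanishes, and B moves left through the powers of A. *)
- rewrite sum_Sn, Nat.sub_diag.
  replace (of_real F (INR 0)) with (zero : scalars F) by now destruct F.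
  eapply eq_trans.
  { apply f_equal2; [reflexivity |].
    eapply eq_trans; [| apply (mult_zero_r (K := op_Ring (X := X)))].
    apply f_equal2; [reflexivity |].
    apply (scal_zero_l (V := op_ModuleSpace (X := X))). }
  rewrite plus_zero_r.
  eapply eq_trans; [| apply (sum_n_mult_l (K := op_Ring (X := X)))].
  apply sum_n_ext_loc; intros i Hi.
  rewrite Nat.sub_succ_l, exp_term_S, !mult_assoc by assumption.
  f_equal; unfold exp_term; rewrite scal_mult_r, scal_mult_l.
  now rewrite pow_n_comm_r.
Qed.

Lemma convolution_exp_term A B (k : nat) :
  mult A B = mult B A ->
  convolution (exp_term A) (exp_term B) k = exp_term (plus A B) k.
Proof.
intros H; induction k as [| k IH].
{ unfold convolution; rewrite sum_O; simpl.
  now rewrite !exp_term_0, mult_one_l. }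
apply (scal_of_real_inj (INR (S k))); [now apply not_0_INR |].
eapply eq_trans; [now apply convolution_exp_term_S |].
now rewrite IH, <- exp_term_S.
Qed.

Lemma op_exp_unique A E : is_series (exp_term A) E -> op_exp A = E.
Proof.
exact (filterlim_locally_unique (F := eventually)
         (V := op_NormedModule (X := X)) _ _ _ (op_exp_correct A)).
Qed.

Lemma op_exp_plus A B :
  mult A B = mult B A -> op_exp (plus A B) = mult (op_exp A) (op_exp B).
Proof.
intros H; apply op_exp_unique.
apply is_series_ext with (convolution (exp_term A) (exp_term B)).
{ intros k; now apply convolution_exp_term. }
apply is_series_convolution;
  first [apply op_exp_correct | apply ex_series_norm_exp_term].
Qed.

Lemma is_linear_eval (x : X) : is_linear (fun A : bounded_op X => A x).
Proof.
split; [reflexivity | reflexivity |].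
exists (norm x + 1); split; [generalize (norm_ge_0 x); lra |].
intros A; apply Rle_trans with (1 := op_norm_apply A x).
rewrite Rmult_comm; apply Rmult_le_compat_r; [apply op_norm_ge_0 | lra].
Qed.

Lemma is_series_op_exp_apply A (x : X) :
  is_series (fun k => exp_term A k x) (op_exp A x).
Proof.
apply (is_series_linear (fun D : bounded_op X => D x));
  [apply is_linear_eval | apply op_exp_correct].
Qed.

Lemma op_exp_comm A B :
  mult A B = mult B A -> mult B (op_exp A) = mult (op_exp A) B.
Proof.
intros H; apply bounded_op_eq; intros x.
apply (filterlim_locally_unique (F := eventually)
         (sum_n (fun k => B (exp_term A k x)))).
- apply (is_series_linear B);
    [apply bounded_op_linear | apply is_series_op_exp_apply].
- apply (is_series_ext (fun k => exp_term A k (B x)));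
    [| apply is_series_op_exp_apply].
  intros k; symmetry.
  assert (E : mult B (exp_term A k) = mult (exp_term A k) B).
  { unfold exp_term; rewrite scal_mult_r, scal_mult_l, pow_n_comm_r; easy. }
  exact (f_equal (fun D : bounded_op X => D x) E).
Qed.

Lemma norm_op_exp A : norm (op_exp A) <= exp (norm A).
Proof.
apply (is_series_norm_le (V := op_NormedModule (X := X)) _ _ _ _
         (op_exp_correct A) (is_series_exp (norm A)) (norm_exp_term A)).
Qed.

Lemma fact_mult_le (m k : nat) :
  INR (fact m) * INR (fact k) <= INR (fact (m + k)).
Proof.
rewrite <- mult_INR; apply le_INR.
induction k as [| k IH]; [rewrite Nat.add_0_r; simpl; lia |].
rewrite Nat.add_succ_r, !fact_simpl; nia.
Qed.

(** Since (m + 1 + k)! >= (m + 1)! k!, the term of index m + 1 + k is at most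
    ||A||^k / k! times ||A^(m+1) x|| / (m + 1)!, and these bounds sum to an
    exponential.  Keeping A^(m+1) applied to [x], instead of bounding its norm,
    is what makes the final estimate depend on [x] only through (C - 1)^2 x and
    (C - 1)^3 x. *)
Lemma op_exp_taylor_remainder A (x : X) (m : nat) :
  norm (minus (op_exp A x) (sum_n (fun k => exp_term A k x) m))
  <= exp (norm A) / INR (fact (S m)) * norm ((pow_n A (S m) : bounded_op X) x).
Proof.
set (c := / INR (fact (S m)) * norm ((pow_n A (S m) : bounded_op X) x)).
replace (_ / _ * _) with (c * exp (norm A)).
2: { unfold c; field; apply INR_fact_neq_0. }
apply (is_series_norm_le (fun k => exp_term A (S m + k) x) _
         (fun k => c * (/ INR (fact k) * norm A ^ k))).
- apply (is_series_incr_n (fun k => exp_term A k x)); [lia | simpl].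
  replace (plus _ _) with (op_exp A x).
  2: { symmetry; exact (plus_minus_cancel (G := X) _ _). }
  apply is_series_op_exp_apply.
- apply (is_series_scal_l (K := R_AbsRing) (V := R_NormedModule) c).
  apply is_series_exp.
- intros k; unfold exp_term.
  replace (pow_n A (S m + k)) with (mult (pow_n A k) (pow_n A (S m))).
  2: { now rewrite pow_n_comm, pow_n_plus. }
  change (norm (scal (of_real F (/ INR (fact (S m + k))))
    ((pow_n A k : bounded_op X) ((pow_n A (S m) : bounded_op X) x)))
    <= c * (/ INR (fact k) * norm A ^ k)).
  set (y := (pow_n A (S m) : bounded_op X) x) in *.
  assert (Hp : forall j, 0 < INR (fact j)) by exact INR_fact_lt_0.
  rewrite norm_scal_of_real, Rabs_pos_eq.
  2: now apply Rlt_le, Rinv_0_lt_compat.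
  replace (c * (/ INR (fact k) * norm A ^ k)) with
    (/ (INR (fact (S m)) * INR (fact k)) * (norm A ^ k * norm y)).
  2: { unfold c; field; split; apply INR_fact_neq_0. }
  apply Rmult_le_compat.
  + now apply Rlt_le, Rinv_0_lt_compat.
  + apply norm_ge_0.
  + apply Rinv_le_contravar; [now apply Rmult_lt_0_compat |].
    apply fact_mult_le.
  + apply Rle_trans with (1 := op_norm_apply _ _).
    apply Rmult_le_compat_r; [apply norm_ge_0 | apply op_norm_pow].
Qed.

Lemma norm_op_exp_minus_id A (x : X) :
  norm (minus (op_exp A x) x) <= exp (norm A) * norm (A x).
Proof.
generalize (op_exp_taylor_remainder A x 0).
rewrite sum_O, exp_term_0; simpl.
replace (mult A one) with A by now rewrite mult_one_r.
now rewrite Rdiv_1_r.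
Qed.

Lemma op_exp_zero : op_exp (zero : bounded_op X) = one.
Proof.
apply bounded_op_eq; intros x.
assert (H : norm (minus (op_exp (zero : bounded_op X) x) x) <= 0).
{ apply Rle_trans with (1 := norm_op_exp_minus_id zero x).
  replace (norm ((zero : bounded_op X) x)) with 0.
  2: { symmetry; exact (norm_zero (V := X)). }
  rewrite Rmult_0_r; apply Rle_refl. }
apply (plus_reg_r (G := X) (opp x)).
change (minus (op_exp (zero : bounded_op X) x) x = minus x x).
rewrite minus_eq_zero; apply norm_eq_zero, Rle_antisym;
  [exact H | apply norm_ge_0].
Qed.

Lemma mult_scal_comm (s t : R) A :
  mult (scal (of_real F s) A) (scal (of_real F t) A)
  = mult (scal (of_real F t) A) (scal (of_real F s) A).
Proof.
rewrite !scal_mult_l, !scal_mult_r, !scal_assoc; f_equal.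
apply scalars_mult_comm.
Qed.

Lemma op_exp_scal_plus (s t : R) A :
  op_exp (scal (of_real F (s + t)) A)
  = mult (op_exp (scal (of_real F s) A)) (op_exp (scal (of_real F t) A)).
Proof.
rewrite of_real_plus, <- op_exp_plus by apply mult_scal_comm.
f_equal; apply (scal_distr_r (V := op_ModuleSpace (X := X))).
Qed.

(** The exponential of a scalar operator is the scalar e^t.  The growth bound
    [norm_op_exp] would only give e^|t|, which is too weak for t < 0, where the
    decay is needed to compensate e^(tC). *)
Lemma norm_op_exp_scal_one (t : R) :
  norm (op_exp (scal (of_real F t) (one : bounded_op X))) <= exp t.
Proof.
replace (op_exp _) with (scal (of_real F (exp t)) (one : bounded_op X)).
{ apply Rle_trans with (1 := op_norm_scal _ _).
  rewrite abs_of_real, Rabs_pos_eq by apply Rlt_le, exp_pos.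
  rewrite <- (Rmult_1_r (exp t)) at 2.
  apply Rmult_le_compat_l; [apply Rlt_le, exp_pos | apply op_norm_one]. }
symmetry; apply op_exp_unique.
set (a := fun k => / INR (fact k) * t ^ k).
apply filterlim_ext with (fun n => scal (of_real F (sum_n a n)) (one : bounded_op X)).
{ assert (E : forall k, exp_term (scal (of_real F t) (one : bounded_op X)) k
             = scal (of_real F (a k)) (one : bounded_op X)).
  { intros k; unfold exp_term, a.
    rewrite pow_n_scal, scal_assoc, <- of_real_mult; f_equal.
    induction k as [| k IH]; [reflexivity | simpl].
    now rewrite IH, mult_one_l. }
  induction x as [| n IH]; [now rewrite !sum_O, E |].
  rewrite !sum_Sn, E, <- IH.
  eapply eq_trans; [| apply (scal_distr_r (V := op_ModuleSpace (X := X)))].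
  f_equal; apply of_real_plus. }
apply filterlim_of_norm_le with
  (fun n => Rabs (sum_n a n - exp t) * norm (one : bounded_op X)).
- intros n; rewrite <- (abs_of_real F).
  eapply Rle_trans; [| apply op_norm_scal].
  apply Req_le, (f_equal op_norm); symmetry.
  unfold Rminus; rewrite of_real_plus.
  eapply eq_trans; [apply (scal_distr_r (V := op_ModuleSpace (X := X))) |].
  unfold minus; f_equal.
  apply scal_of_real_opp.
- change (is_lim_seq (fun n => Rabs (sum_n a n - exp t) * norm (one : bounded_op X)) 0).
  replace 0 with (0 * norm (one : bounded_op X)) by ring.
  apply is_lim_seq_mult'; [| apply is_lim_seq_const].
  apply (is_lim_seq_abs_0 (fun n => sum_n a n - exp t)).
  replace 0 with (exp t - exp t) by ring.
  apply is_lim_seq_minus'; [exact (is_series_exp t) | apply is_lim_seq_const].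
Qed.

(** * The contraction semigroup generated by C - 1 *)

Lemma op_exp_contraction (C : bounded_op X) (t : R) :
  norm C <= 1 -> 0 <= t ->
  norm (op_exp (scal (of_real F t) (minus C one))) <= 1.
Proof.
intros HC Ht.
replace (scal (of_real F t) (minus C one))
  with (plus (scal (of_real F t) C)
          (scal (of_real F (- t)) (one : bounded_op X))).
2: { unfold minus; symmetry.
  eapply eq_trans; [apply (scal_distr_l (V := op_ModuleSpace (X := X))) |].
  f_equal; rewrite scal_of_real_opp.
  apply (scal_opp_r (V := op_ModuleSpace (X := X))). }
rewrite op_exp_plus.
2: { rewrite scal_mult_r, !scal_mult_l, scal_mult_r, mult_one_l, mult_one_r.
  rewrite !scal_assoc; f_equal; apply scalars_mult_comm. }
apply Rle_trans with (1 := op_norm_comp _ _).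
apply Rle_trans with (exp t * exp (- t)).
2: { rewrite <- exp_plus, Rplus_opp_r, exp_0; apply Rle_refl. }
apply Rmult_le_compat; try apply op_norm_ge_0; [| apply norm_op_exp_scal_one].
apply Rle_trans with (1 := norm_op_exp _).
apply exp_monotone; apply Rle_trans with (1 := op_norm_scal _ _).
rewrite abs_of_real, Rabs_pos_eq by assumption.
rewrite <- (Rmult_1_r t) at 2; now apply Rmult_le_compat_l.
Qed.

(** By the semigroup law, e^(sA) - e^(tA) = e^(tA) (e^((s-t)A) - 1), so only
    continuity at time zero matters. *)
Lemma op_exp_scal_continuous A (t : R) :
  filterlim (fun s => op_exp (scal (of_real F s) A)) (locally t)
    (locally (op_exp (scal (of_real F t) A))).
Proof.
set (T := fun s => op_exp (scal (of_real F s) A)).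
set (h := fun r => norm (T t) * (exp (Rabs r * norm A) * (Rabs r * norm A))).
apply (filterlim_of_norm_le (V := op_NormedModule (X := X))
         _ _ (fun s => h (s - t))).
- intros s.
  apply Rle_trans with (norm (mult (T t) (minus (T (s - t)) one))).
  { apply Req_le, (f_equal op_norm); symmetry.
    eapply eq_trans; [apply (mult_minus_r (K := op_Ring (X := X))) |].
    rewrite mult_one_r; unfold T; rewrite <- op_exp_scal_plus.
    now replace (t + (s - t)) with s by ring. }
  apply Rle_trans with (1 := op_norm_comp _ _).
  apply Rmult_le_compat_l; [apply op_norm_ge_0 |].
  assert (HA : norm (scal (of_real F (s - t)) A) <= Rabs (s - t) * norm A).
  { rewrite <- (abs_of_real F); apply op_norm_scal. }
  assert (HE : exp (norm (scal (of_real F (s - t)) A))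
               <= exp (Rabs (s - t) * norm A)) by now apply exp_monotone.
  assert (H0 : 0 <= norm (scal (of_real F (s - t)) A)) by apply op_norm_ge_0.
  apply op_norm_le_apply.
  { apply Rmult_le_pos; [apply Rlt_le, exp_pos | now apply Rle_trans with (2 := HA)]. }
  intros x; apply Rle_trans with (1 := norm_op_exp_minus_id _ x).
  rewrite Rmult_assoc; apply Rmult_le_compat.
  + apply Rlt_le, exp_pos.
  + apply norm_ge_0.
  + exact HE.
  + apply Rle_trans with (1 := op_norm_apply _ x).
    apply Rmult_le_compat_r; [apply norm_ge_0 | exact HA].
- assert (Hc : continuity_pt (fun s => h (s - t)) t) by (unfold h; reg).
  apply continuity_pt_filterlim in Hc.
  replace 0 with (h (t - t)); [exact Hc |].
  unfold h; rewrite Rminus_diag, Rabs_R0; ring.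
Qed.

Lemma op_exp_scal_semigroup (C : bounded_op X) :
  norm C <= 1 ->
  norm_continuous_contraction_semigroup
    (fun t => op_exp (scal (of_real F t) (minus C one))).
Proof.
intros HC; split.
- rewrite <- op_exp_zero; f_equal.
  replace (of_real F 0) with (zero : scalars F) by now destruct F.
  apply (scal_zero_l (V := op_ModuleSpace (X := X))).
- intros s t _ _; apply op_exp_scal_plus.
- intros t _.
  eapply filterlim_filter_le_1;
    [apply filter_le_within | apply op_exp_scal_continuous].
- intros t Ht; now apply op_exp_contraction.
Qed.

(** * Comparing powers of a contraction with the semigroup *)

Lemma pow_n_op_exp A (n : nat) :
  pow_n (op_exp A) n = op_exp (scal (of_real F (INR n)) A).
Proof.
induction n as [| n IH].
- simpl; rewrite <- op_exp_zero at 1; f_equal.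
  replace (of_real F 0) with (zero : scalars F) by now destruct F.
  symmetry; apply (scal_zero_l (V := op_ModuleSpace (X := X))).
- rewrite S_INR, Rplus_comm, op_exp_scal_plus, of_real_1, <- IH.
  simpl; f_equal; f_equal; symmetry; apply scal_one.
Qed.

Lemma norm_pow_le_1 A (n : nat) : norm A <= 1 -> norm (pow_n A n) <= 1.
Proof.
intros HA; apply Rle_trans with (1 := op_norm_pow A n).
rewrite <- (pow1 n); apply pow_incr; split; [apply op_norm_ge_0 | exact HA].
Qed.

Lemma norm_contraction_apply A (x : X) : norm A <= 1 -> norm (A x) <= norm x.
Proof.
intros HA; apply Rle_trans with (1 := op_norm_apply A x).
rewrite <- (Rmult_1_l (norm x)) at 2.
apply Rmult_le_compat_r; [apply norm_ge_0 | exact HA].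
Qed.

(** In the telescoping sum every factor other than A - B is a contraction, so
    each of the [n] terms costs at most ||(A - B) x||. *)
Lemma norm_pow_minus_pow A B (n : nat) (x : X) :
  norm A <= 1 -> norm B <= 1 -> mult A B = mult B A ->
  norm ((minus (pow_n A n) (pow_n B n) : bounded_op X) x)
  <= INR n * norm ((minus A B : bounded_op X) x).
Proof.
intros HA HB HAB; induction n as [| n IH].
{ rewrite Rmult_0_l; apply Req_le; change (norm (minus x x) = 0).
  rewrite minus_eq_zero; exact (norm_zero (V := X)). }
replace (minus (pow_n A (S n)) (pow_n B (S n)))
  with (plus (mult A (minus (pow_n A n) (pow_n B n)))
             (mult (pow_n B n) (minus A B))).
2: { symmetry; exact (minus_pow_n_S (K := op_Ring (X := X)) A B n HAB). }
apply Rle_trans with (1 := norm_triangle _ _).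
rewrite S_INR, Rmult_plus_distr_r, Rmult_1_l.
apply Rplus_le_compat.
- apply Rle_trans with (2 := IH).
  exact (norm_contraction_apply A _ HA).
- exact (norm_contraction_apply (pow_n B n) _ (norm_pow_le_1 B n HB)).
Qed.

(** C = 1 + (C - 1) is the Taylor polynomial of degree one of e^(C-1), so the
    difference starts at the quadratic term; going to order three leaves the
    constant e^2 / 3!, because ||C - 1|| <= 2. *)
Lemma norm_minus_op_exp (C : bounded_op X) (x : X) :
  norm C <= 1 ->
  norm ((minus C (op_exp (minus C one)) : bounded_op X) x)
  <= / 2 * norm ((pow_n (minus C one) 2 : bounded_op X) x)
     + exp 2 / 6 * norm ((pow_n (minus C one) 3 : bounded_op X) x).
Proof.
intros HC; set (A := minus C one).
set (S2 := sum_n (fun k => exp_term A k x) 2).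
assert (HA : norm A <= 2).
{ apply Rle_trans with (1 := op_norm_plus C (opp one)).
  apply (Rplus_le_compat _ 1 _ 1 HC).
  apply Rle_trans with (op_norm (one : bounded_op X)).
  - apply Req_le, op_norm_opp.
  - apply op_norm_one. }
rewrite minus_opE, (minus_trans S2).
apply Rle_trans with (1 := norm_triangle _ _); apply Rplus_le_compat.
- replace (minus (C x) S2)
    with (opp (scal (of_real F (/ 2)) ((pow_n A 2 : bounded_op X) x))).
  { apply Rle_trans with (1 := Req_le _ _ (norm_opp (V := X) _)).
    rewrite norm_scal_of_real, Rabs_pos_eq by lra; apply Rle_refl. }
  unfold S2; rewrite !sum_Sn, sum_O, exp_term_0.
  replace (exp_term A 1) with A.
  2: { unfold exp_term; simpl; rewrite mult_one_r, Rinv_1, of_real_1.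
    symmetry; apply scal_one. }
  replace (C x) with (plus ((one : bounded_op X) x) (A x)).
  2: { exact (eq_trans (plus_comm (G := X) _ _) (plus_minus_cancel (G := X) _ _)). }
  symmetry; exact (minus_plus_l (G := X) _ _).
- rewrite <- norm_opp, opp_minus.
  apply Rle_trans with (1 := op_exp_taylor_remainder A x 2).
  apply Rmult_le_compat_r; [apply norm_ge_0 |].
  replace (INR (fact 3)) with 6 by (simpl; ring).
  apply Rmult_le_compat_r; [lra |].
  now apply exp_monotone.
Qed.

End Exponential.

Theorem theorem3p1 (F : scalar_field) (X : CompleteNormedModule (scalars F))
    (C : bounded_op X) (hC : norm C <= 1) :
  norm_continuous_contraction_semigroup
    (fun t : R => op_exp (scal (of_real F t) (minus C one)))
  /\
  forall (n : nat) (x : X), (1 <= n)%nat ->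
    norm ((minus (pow_n C n)
             (op_exp (scal (of_real F (INR n)) (minus C one))) : bounded_op X) x)
    <= INR n / 2 *
       (norm ((pow_n (minus C one) 2 : bounded_op X) x)
        + exp 2 / 3 * norm ((pow_n (minus C one) 3 : bounded_op X) x)).
Proof.
split; [now apply op_exp_scal_semigroup |].
intros n x _.
rewrite <- pow_n_op_exp.
eapply Rle_trans.
{ apply norm_pow_minus_pow; [exact hC | |].
  - generalize (op_exp_contraction C 1 hC Rle_0_1).
    now rewrite of_real_1, scal_one.
  - apply op_exp_comm.
    exact (minus_one_comm (K := op_Ring (X := X)) C). }
eapply Rle_trans.
{ apply Rmult_le_compat_l; [apply pos_INR | now apply norm_minus_op_exp]. }
apply Req_le; field.
Qed.
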